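(* Let $\psi\colon\mathbb{R}^n\times\mathbb{R}^m\times\mathbb{R}_+\to\mathbb{R}^d$ be a basis satisfying Assumption A1 (stated in the context), let $H^\theta=\theta^\intercal\psi$ for $\theta\in\mathbb{R}^d$, fix $\sigma>0$, $\mathcal{T}>0$ and $\mathrm{Tol}>0$, and let $\{(x_t,u_t):0\le t\le\mathcal{T}\}$ be a given input-state trajectory. Write $\psi_t=\psi(x_t,u_t,t)$. Define $$\Theta=\Bigl\{\theta\in\mathbb{R}^d:\frac1{\mathcal{T}}\int_0^{\mathcal{T}}\bigl[\mathcal{B}^\theta_r\bigr]_+\,dr\le\mathrm{Tol}\Bigr\},$$ where $$\mathcal{B}^\theta_r=-\underline{H}^\theta(x_{\mathcal{T}-r},\mathcal{T}-r)-\sigma e^{-\sigma r}J_0(x_{\mathcal{T}})+\sigma\int_0^re^{-\sigma(r-s)}\theta^\intercal\psi_{\mathcal{T}-s}\,ds-\sigma\int_0^re^{-\sigma(r-s)}c(x_{\mathcal{T}-s},u_{\mathcal{T}-s},\mathcal{T}-s)\,ds .$$ (i) If the set $\{\psi_t:0\le t\le\mathcal{T}\}$ is not restricted to any half space in $\mathbb{R}^d$ (Condition E1), then $\Theta$ is bounded. (ii) Conversely, if $\Theta$ is bounded, then Condition E2 holds: the only vector $v\in\mathbb{R}^d$ satisfying $$\underline{H}^v(x_{\mathcal{T}-r},\mathcal{T}-r)\ \ge\ \sigma\int_0^re^{-\sigma(r-s)}v^\intercal\psi_{\mathcal{T}-s}\,ds\qquad\text{for all }0\le r\le\mathcal{T}$$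 is $v=0$.
   Context: The state equation is $\frac{d}{dt}x_t=F(x_t,u_t,t)$ with $x_t\in\mathbb{R}^n$, $u_t\in\mathbb{R}^m$; an input-state trajectory is a solution $(x_t,u_t)_{0\le t\le\mathcal{T}}$ with $u$ continuous. The running cost is $c\colon\mathbb{R}^n\times\mathbb{R}^m\times\mathbb{R}_+\to\mathbb{R}_+$ and the terminal cost is $J_0\colon\mathbb{R}^n\to\mathbb{R}_+$. Assumption A1: The function class is linear, $\{H^\theta=\theta^\intercal\psi:\theta\in\mathbb{R}^d\}$. The basis $\psi$ and the cost function $c$ are continuously differentiable. Moreover, for each $\theta\in\mathbb{R}^d$, the minimum in $\phi^\theta(x,t)=\arg\min_uH^\theta(x,u,t)$ defines a continuous feedback law $\phi^\theta\colon\mathbb{R}^n\times\mathbb{R}_+\to\mathbb{R}^m$, and with $u_t=\phi^\theta(x_t,t)$ for $0\le t\le\mathcal{T}$ there is a solution to the state equation. Notation: $\underline{H}^\theta(x,t)=\min_{u\in\mathbb{R}^m}H^\theta(x,u,t)$; $[s]_+=\max(0,s)$. A half space in $\mathbb{R}^d$ means a closed half space with the origin on its boundary, $\{y\in\mathbb{R}^d:v^\intercal y\ge0\}$ with $v\ne0$; ''restricted to'' means ''contained in''. *)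

(* Defs.v *)
From HB Require Import structures.
From mathcomp Require Import all_boot all_order all_algebra.
From mathcomp Require Import all_classical all_reals all_analysis.

Set Implicit Arguments.
Unset Strict Implicit.
Unset Printing Implicit Defensive.

Import Order.TTheory GRing.Theory Num.Theory.
Import numFieldNormedType.Exports.
Local Open Scope classical_set_scope.
Local Open Scope ring_scope.

(* Functions of time are total on R, with no constraint outside the time set on
   which the mathematical function lives (R_+ or [0, T]); continuity and
   differentiability are therefore always taken relative to that set. *)

Definition dot (R : realType) (d : nat) (v y : 'cV[R]_d) : R :=
  (v^T *m y) ord0 ord0.

(* C^1 on a set D that need not be open: Frechet differentiable relative to D
   at every point of D, with a derivative that is continuous on D.  For
   finite-dimensional V, pointwise continuity of p |-> df p v is the same as
   continuity in operator norm. *)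
Definition C1_on (R : realType) (V W : normedModType R) (D : set V)
    (f : V -> W) : Prop :=
  exists df : V -> {linear V -> W},
    [/\ forall p, D p -> continuous (df p),
        forall p, D p -> forall y,
          f y = f p + df p (y - p) +o_(y \near within D (nbhs p)) (y - p)
      & forall v, {within D, continuous (fun p => df p v)}].

Definition C1_xut (R : realType) (n m : nat) (W : normedModType R)
    (f : 'cV[R]_n -> 'cV[R]_m -> R -> W) : Prop :=
  C1_on [set p : 'cV[R]_n * 'cV[R]_m * R | 0 <= p.2]
        (fun p => f p.1.1 p.1.2 p.2).

(* One-sided derivatives at the endpoints 0 and T. *)
Definition state_equation (R : realType) (n m : nat)
    (F : 'cV[R]_n -> 'cV[R]_m -> R -> 'cV[R]_n) (T : R)
    (x : R -> 'cV[R]_n) (u : R -> 'cV[R]_m) : Prop :=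
  forall t, t \in `[0, T] ->
    (fun s => (s - t)^-1 *: (x s - x t)) @ within `[0, T] (dnbhs t)
      --> F (x t) (u t) t.

Definition input_state_trajectory (R : realType) (n m : nat)
    (F : 'cV[R]_n -> 'cV[R]_m -> R -> 'cV[R]_n) (T : R)
    (x : R -> 'cV[R]_n) (u : R -> 'cV[R]_m) : Prop :=
  state_equation F T x u /\ {within `[0, T], continuous u}.

Section LinearFunctionClass.
Variables (R : realType) (n m d : nat).
Variable psi : 'cV[R]_n -> 'cV[R]_m -> R -> 'cV[R]_d.

Definition Hfun (theta : 'cV[R]_d) (x : 'cV[R]_n) (u : 'cV[R]_m) (t : R) : R :=
  dot theta (psi x u t).

(* The infimum is attained under [assumption_A1]. *)
Definition Hmin (theta : 'cV[R]_d) (x : 'cV[R]_n) (t : R) : R :=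
  inf [set Hfun theta x u t | u in [set: 'cV[R]_m]].

(* The minimizer need not be unique (for theta = 0 every u is one), so phi is
   a continuous selection of the argmin.  The closed-loop solution is required for
   at least one initial state; prescribing the initial state(s) would only
   strengthen the assumption. *)
Definition assumption_A1 (F : 'cV[R]_n -> 'cV[R]_m -> R -> 'cV[R]_n) (T : R)
    (c : 'cV[R]_n -> 'cV[R]_m -> R -> R) : Prop :=
  [/\ C1_xut psi,
      C1_xut c
    & forall theta : 'cV[R]_d, exists phi : 'cV[R]_n -> R -> 'cV[R]_m,
        [/\ forall x t, 0 <= t -> forall u,
              Hfun theta x (phi x t) t <= Hfun theta x u t,
            {within [set p : 'cV[R]_n * R | 0 <= p.2],
              continuous (fun p => phi p.1 p.2)}
          & exists x : R -> 'cV[R]_n,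
              state_equation F T x (fun t => phi (x t) t)]].

Variables (c : 'cV[R]_n -> 'cV[R]_m -> R -> R) (J0 : 'cV[R]_n -> R).
Variables (sigma T : R) (x : R -> 'cV[R]_n) (u : R -> 'cV[R]_m).

Definition psi_traj (t : R) : 'cV[R]_d := psi (x t) (u t) t.

(* [discounted y r] is sigma * int_0^r e^{-sigma (r - s)} y_{T - s} ds. *)
Definition discounted (y : R -> R) (r : R) : R :=
  sigma * \int[lebesgue_measure]_(s in `[0, r])
            (expR (- sigma * (r - s)) * y (T - s)).

Definition Bellman (theta : 'cV[R]_d) (r : R) : R :=
  - Hmin theta (x (T - r)) (T - r)
  - sigma * expR (- sigma * r) * J0 (x T)
  + discounted (fun t => dot theta (psi_traj t)) r
  - discounted (fun t => c (x t) (u t) t) r.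

Definition Theta (Tol : R) : set 'cV[R]_d :=
  [set theta | T^-1 * \int[lebesgue_measure]_(r in `[0, T])
                        Num.max 0 (Bellman theta r) <= Tol].

Definition half_space (S : set 'cV[R]_d) : Prop :=
  exists2 v : 'cV[R]_d, v != 0 & S = [set y | 0 <= dot v y].

Definition condition_E1 : Prop :=
  forall S, half_space S -> ~ (psi_traj @` `[0, T] `<=` S).

Definition condition_E2 : Prop :=
  forall v : 'cV[R]_d,
    (forall r, 0 <= r <= T ->
       Hmin v (x (T - r)) (T - r)
         >= discounted (fun t => dot v (psi_traj t)) r)
    <-> v = 0.

End LinearFunctionClass.

(* Main.v *)
(* A direction [v] recedes in Theta according to the sign of [D - Hmin v], where
   [D r] is the discounted integral of [y s = v^T psi_(T - s)] up to [r].

   (ii) If [D <= Hmin v] on [0, T], then the Bellman error of [a *: v] is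
   nonpositive for every [a >= 0], so Theta contains the ray through [v].

   (i) Fix [v != 0].  If [D <= Hmin v] held throughout, then [D <= y] because
   [Hmin v] is at most [y]; as [D' = sigma (y - D)] and [D 0 = 0] this gives
   [0 <= D <= y], a half space containing the trajectory.  Hence
   [Hmin v < D] at some [r0].  Freezing the minimizer [w] of [v] at that time
   bounds the Bellman error of every theta from below by an affine function of
   theta, [theta^T p r - k r] with [p] continuous and [0 < v^T p r0].
   Integrating over a neighbourhood of [r0] confines Theta to a half space
   [theta^T P <= K] with [0 < v^T P], so [v] is not a recession direction, and
   compactness of the unit sphere bounds Theta. *)

Require Import Defs.
From mathcomp Require Import all_boot all_order all_algebra.
From mathcomp Require Import all_classical all_reals all_analysis.
From mathcomp Require Import lra.
Import Order.TTheory GRing.Theory Num.Theory.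
Import numFieldNormedType.Exports.
Local Open Scope classical_set_scope.
Local Open Scope ring_scope.

Set Implicit Arguments.
Unset Strict Implicit.

(** * The pairing [dot]: linearity and continuity *)

Lemma dotE (R : realType) (d : nat) (v y : 'cV[R]_d) :
  dot v y = \sum_(i < d) v i ord0 * y i ord0.
Proof. by rewrite /dot mxE; apply: eq_bigr => i _; rewrite mxE. Qed.

Lemma dotZl (R : realType) (d : nat) (a : R) (v y : 'cV[R]_d) :
  dot (a *: v) y = a * dot v y.
Proof. by rewrite /dot linearZ/= -scalemxAl mxE. Qed.

Lemma dotZr (R : realType) (d : nat) (a : R) (v y : 'cV[R]_d) :
  dot v (a *: y) = a * dot v y.
Proof. by rewrite /dot -scalemxAr mxE. Qed.

Lemma dotDr (R : realType) (d : nat) (v y z : 'cV[R]_d) :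
  dot v (y + z) = dot v y + dot v z.
Proof. by rewrite /dot mulmxDr mxE. Qed.

Lemma dotNr (R : realType) (d : nat) (v y : 'cV[R]_d) :
  dot v (- y) = - dot v y.
Proof. by rewrite /dot mulmxN mxE. Qed.

Lemma dot0l (R : realType) (d : nat) (y : 'cV[R]_d) : dot 0 y = 0.
Proof. by rewrite /dot trmx0 mul0mx mxE. Qed.

Lemma mul_continuous (R : realType) (X : topologicalType) (f g : X -> R) :
  continuous f -> continuous g -> continuous (fun x => f x * g x).
Proof. by move=> cf cg x; apply: cvgM; [exact: cf|exact: cg]. Qed.

Lemma sum_continuous (R : realType) (X : topologicalType) (d : nat)
  (F : 'I_d -> X -> R) :
  (forall i, continuous (F i)) -> continuous (fun x => \sum_(i < d) F i x).
Proof.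
move=> cF; elim: d F cF => [|d IH] F cF x.
  rewrite (_ : (fun _ => _) = fun=> 0); first exact: cvg_cst.
  by apply/funext => y; rewrite big_ord0.
rewrite (_ : (fun _ => _) =
    fun y => \sum_(i < d) F (widen_ord (leqnSn d) i) y + F ord_max y).
  by apply: cvgD; [exact: IH|exact: cF].
by apply/funext => y; rewrite big_ord_recr.
Qed.

Lemma dot_continuous (R : realType) (X : topologicalType) (d : nat)
  (v : 'cV[R]_d) (y : X -> 'cV[R]_d) :
  (forall i, continuous (fun x => y x i ord0)) ->
  continuous (fun x => dot v (y x)).
Proof.
move=> cy; rewrite (_ : (fun _ => _) =
    fun x => \sum_(i < d) v i ord0 * y x i ord0).
  apply: sum_continuous => i; apply: mul_continuous => //.
  exact: cst_continuous.
by apply/funext => x; rewrite dotE.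
Qed.

Lemma coord_comp_continuous (R : realType) (d : nat) (X : topologicalType)
  (Y : X -> 'cV[R]_d) (i : 'I_d) :
  continuous Y -> continuous (fun s => Y s i ord0).
Proof.
move=> cY s; exact: (cvg_comp _ (fun M : 'cV[R]_d => M i ord0) (cY s)
    (@coord_continuous _ _ _ i ord0 (Y s))).
Qed.

Lemma dot_comp_continuous (R : realType) (X : topologicalType) (d : nat)
  (v : 'cV[R]_d) (y : X -> 'cV[R]_d) :
  continuous y -> continuous (fun x => dot v (y x)).
Proof.
by move=> cy; apply: dot_continuous => i; exact: coord_comp_continuous.
Qed.

Lemma dot_tr_continuousl (R : realType) (d : nat) (y : 'cV[R]_d) :
  continuous (fun v : 'rV[R]_d => dot v^T y).
Proof.
rewrite (_ : (fun _ => _) =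
    fun v : 'rV[R]_d => \sum_(i < d) v ord0 i * y i ord0).
  apply: sum_continuous => i; apply: mul_continuous.
    exact: coord_continuous.
  exact: cst_continuous.
by apply/funext => v; rewrite dotE; apply: eq_bigr => i _; rewrite mxE.
Qed.

(** * Boundedness from the absence of recession directions *)

Lemma normr_tr (R : realType) (d : nat) (v : 'cV[R]_d) : `|v^T| = `|v|.
Proof.
rewrite /Num.norm/= !mx_normrE; apply/eqP; rewrite eq_le; apply/andP; split.
- apply: bigmax_le; first by exact: bigmax_ge_id.
  move=> [i j] _; rewrite mxE/=.
  exact: (le_bigmax _ (fun ij : 'I_d * 'I_1 => `|v ij.1 ij.2|) (j, i)).
- apply: bigmax_le; first by exact: bigmax_ge_id.
  move=> [i j] _ /=; have := le_bigmax (0:R) (fun ij : 'I_1 * 'I_d => `|v^T ij.1 ij.2|) (j, i).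
  by rewrite /= mxE.
Qed.

(* The hypothesis rules out every [v] as a recession direction of [A], without
   requiring [A] to be closed or convex. *)
Lemma bounded_set_of_half_spaces (R : realType) (d : nat) (A : set 'cV[R]_d) :
  (forall v, v != 0 -> exists P, exists C, 0 < dot v P /\
     forall y, A y -> dot y P <= C) ->
  bounded_set A.
Proof.
move=> H.
(* The sphere consists of row vectors, the setting of [bounded_closed_compact]; [normr_tr] carries
   norms back to columns. *)
pose S := [set v : 'rV[R]_d | `|v| = 1].
have cS : compact S.
  apply: bounded_closed_compact.
    exists 1; split; first exact: real1.
    by move=> M M1 v /= ->; exact: ltW.
  apply: (@closed_comp _ _ (fun v : 'rV[R]_d => `|v|) [set 1]).
    by move=> v _; exact: norm_continuous.
  exact: closed_eq.
have /compact_near_coveringP nS := cS.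
(* By compactness, a bound on the admissible lengths [a] that is locally uniform in the direction
   [w] is uniform over the sphere. *)
have : \forall M \near +oo, S `<=`
    (fun w : 'rV[R]_d => forall a, 0 <= a -> A (a *: w^T) -> a <= M).
  apply: nS => v Sv.
  have vn0 : v^T != 0.
    apply/eqP => v0; have : v = 0 by rewrite -[v]trmxK v0 trmx0.
    by move=> vE; move: Sv; rewrite /S/= vE normr0 => /eqP; rewrite eq_sym oner_eq0.
  have [P [C [vP AP]]] := H _ vn0.
  (* Half the pairing at [v] stays a lower bound for the pairing at nearby [w], so
     [a * e <= a * dot w^T P <= C] and [a <= C / e]. *)
  set e := dot v^T P / 2.
  have e0 : 0 < e by rewrite divr_gt0.
  have ev : e < dot v^T P by rewrite /e ltr_pdivrMr// ltr_pMr// ltr1n.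
  exists ([set w : 'rV[R]_d | e < dot w^T P], [set M | C / e <= M]).
    split => /=; last by apply: nbhs_pinfty_ge; exact: num_real.
    exact: (cvgr_gt _ (@dot_tr_continuousl _ _ P v)).
  move=> [w M] [/= eP CM] a a0 Aw.
  rewrite -(ler_pM2r e0).
  apply: (@le_trans _ _ (a * dot w^T P)).
    by apply: ler_wpM2l => //; exact: ltW.
  rewrite -dotZl; apply: (le_trans (AP _ Aw)).
  by rewrite -ler_pdivrMr.
move=> [M0 [_ HM]]; exists (Num.max M0 0); split; first exact: num_real.
move=> M; rewrite gt_max => /andP[M0M M0'] y Ay.
rewrite /mkset; have [->|y0] := eqVneq y 0; first by rewrite normr0 ltW.
have ny0 : `|y| != 0 by rewrite normr_eq0.
apply: (HM M M0M (`|y|^-1 *: y^T)) => //.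
  by rewrite /S/= normrZ normfV normr_id normr_tr mulVf.
by rewrite linearZ/= trmxK scalerA mulfV// scale1r.
Qed.

(** * Continuity of the data relative to their time sets *)

Lemma within_continuous_comp (X Y Z : topologicalType) (D : set Y)
  (q : X -> Y) (f : Y -> Z) :
  (forall x, D (q x)) -> continuous q -> {within D, continuous f} ->
  continuous (f \o q).
Proof.
move=> Dq cq /subspace_continuousP cf x.
(* Since [q] takes values in [D], it converges within [D], which is all that relative continuity of
   [f] asks for. *)
have qw : q @ x --> within D (nbhs (q x)).
  move=> V /(cq x); apply: (@filterS _ (nbhs x)) => y /= DV.
  exact: (DV (Dq y)).
exact: (cvg_comp _ _ qw (cf _ (Dq x))).
Qed.

Lemma C1_on_continuous (R : realType) (V W : normedModType R) (D : set V)
  (f : V -> W) : C1_on D f -> {within D, continuous f}.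
Proof.
move=> [df [cdf dfP _]]; apply/subspace_continuousP => p Dp.
set F := within D (nbhs p).
have FF : Filter F by exact: within_filter.
have /eqaddoP lo : f = (fun y => f p + df p (y - p)) +o_F (fun y => y - p).
  by apply/funext => y; exact: dfP.
have sub0 : y - p @[y --> F] --> (0 : V).
  have c : y - p @[y --> p] --> p - p.
    by apply: cvgB; [exact: cvg_id|exact: cvg_cst].
  by rewrite subrr in c; exact: cvg_within_filter c.
have df0 : df p (y - p) @[y --> F] --> (0 : W).
  rewrite -(linear0 (df p)); apply: cvg_comp sub0 _; exact: (cdf p Dp).
(* Once [y] is within distance 1 of [p], the bound [e * |y - p|] on the remainder is at most [e]. *)
have r0 : f y - (f p + df p (y - p)) @[y --> F] --> (0 : W).
  apply/cvgr0Pnorm_le => e e0.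
  have ny : \forall y \near F, `|y - p| <= 1.
    by move/cvgr0Pnorm_le : sub0; apply.
  near=> y.
  apply: (@le_trans _ _ (e * `|y - p|)); first by near: y; exact: lo.
  by apply: ler_piMr; [exact: ltW|near: y].
have cp : f p @[y --> F] --> f p by exact: cvg_cst.
have fE : f = (fun=> f p) + (fun y => df p (y - p)) +
    (fun y => f y - (f p + df p (y - p))).
  by apply/funext => y; rewrite /= !fctE addrC subrK.
have := cvgD (cvgD cp df0) r0.
by rewrite !addr0 -fE; apply.
Unshelve. all: by end_near. Qed.

(** Nearest-point projection onto [0, T]; precomposing with it trades continuity relative to [0, T]
    for continuity on the line. *)
Definition clamp (R : realType) (T t : R) : R := Num.max 0 (Num.min T t).

Lemma clamp_itv (R : realType) (T t : R) : 0 <= T -> clamp T t \in `[0, T].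
Proof.
by move=> T0; rewrite in_itv/= /clamp le_max lexx/= ge_max T0 ge_min lexx.
Qed.

Lemma clamp_id (R : realType) (T t : R) : t \in `[0, T] -> clamp T t = t.
Proof.
by rewrite in_itv/= /clamp => /andP[t0 tT]; rewrite min_r// max_r.
Qed.

Lemma clamp_continuous (R : realType) (T : R) : continuous (clamp T).
Proof.
move=> t; rewrite /clamp; apply: continuous_max; first exact: cvg_cst.
by apply: continuous_min; [exact: cvg_cst|exact: cvg_id].
Qed.

Lemma comp_clamp_continuous (R : realType) (Z : topologicalType) (T : R)
  (f : R -> Z) :
  0 <= T -> {within `[0, T], continuous f} -> continuous (f \o clamp T).
Proof.
move=> T0; apply: within_continuous_comp; last exact: clamp_continuous.
by move=> t; exact: clamp_itv.
Qed.

(** The increment of [x] is [s - t] times a difference quotient that has a limit, so it tends to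
    0. *)
Lemma state_equation_continuous (R : realType) (n m : nat)
  (F : 'cV[R]_n -> 'cV[R]_m -> R -> 'cV[R]_n) (T : R)
  (x : R -> 'cV[R]_n) (u : R -> 'cV[R]_m) :
  state_equation F T x u -> {within `[0, T], continuous x}.
Proof.
move=> sE; apply/subspace_continuousP => t At.
have dq := sE t At.
have d0 : s - t @[s --> within `[0, T] (dnbhs t)] --> (0 : R).
  have c : s - t @[s --> t] --> t - t.
    by apply: cvgB; [exact: cvg_id|exact: cvg_cst].
  rewrite subrr in c; apply: cvg_within_filter; exact: cvg_within_filter c.
have := cvgZ d0 dq; rewrite scale0r => /(_ _)/cvgr0Pnorm_le z.
apply/cvgrPdist_le => e e0.
have {z} : \forall s \near t, s != t -> `[0, T]%classic s ->
  `|(s - t) *: ((s - t)^-1 *: (x s - x t))| <= e by exact: z.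
(* The punctured limit says nothing at [s = t], where the increment is 0. *)
apply: filterS => s ze As; have [->|st] := eqVneq s t.
  by rewrite subrr normr0 ltW.
by move: (ze st As); rewrite scalerA mulfV ?subr_eq0// scale1r distrC.
Qed.

Lemma pair_continuous (X Y Z : topologicalType) (f : X -> Y) (g : X -> Z) :
  continuous f -> continuous g -> continuous (fun x => (f x, g x)).
Proof. by move=> cf cg x; apply: cvg_pair; [exact: cf|exact: cg]. Qed.

Lemma continuous_integrable (R : realType) (a b : R) (f : R -> R) :
  {within `[a, b], continuous f} ->
  lebesgue_measure.-integrable `[a, b] (EFin \o f).
Proof.
by move=> cf; apply: continuous_compact_integrable => //; exact: segment_compact.
Qed.

(** * Discounted integrals and their differential equation *)

Section Discounted.
Variables (R : realType) (sigma T : R).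
Hypotheses (sigma_gt0 : 0 < sigma) (T_gt0 : 0 < T).
Local Notation mu := lebesgue_measure.

(** For [0 <= s <= r <= T] the time [T - s] stays in [0, T]; this allows replacing the trajectory by
    its clamped version. *)
Lemma eq_discounted (f g : R -> R) (r : R) :
  {in `[0, T], f =1 g} -> r \in `[0, T] ->
  discounted sigma T f r = discounted sigma T g r.
Proof.
move=> fg; rewrite in_itv/= => /andP[r0 rT].
rewrite /discounted; congr (_ * _); apply: eq_Rintegral => s.
rewrite inE/= in_itv/= => /andP[s0 sr]; congr (_ * _); apply: fg.
by rewrite in_itv/= subr_ge0 (le_trans sr rT)/= lerBlDr lerDl.
Qed.

Lemma discounted_ge0 (f : R -> R) (r : R) :
  {in `[0, T], forall t, 0 <= f t} -> r \in `[0, T] ->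
  0 <= discounted sigma T f r.
Proof.
move=> f0; rewrite in_itv/= => /andP[r0 rT].
apply: mulr_ge0; first exact: ltW.
apply: Rintegral_ge0 => s /=; rewrite in_itv/= => /andP[s0 sr].
apply: mulr_ge0; first exact: expR_ge0.
by apply: f0; rewrite in_itv/= subr_ge0 (le_trans sr rT)/= lerBlDr lerDl.
Qed.

Lemma expR_mul_continuous (a : R) : continuous (fun s => expR (a * s)).
Proof.
move=> s; apply: continuous_comp; last exact: continuous_expR.
by apply: cvgM; [exact: cvg_cst|exact: cvg_id].
Qed.

Lemma reversed_continuous (X : topologicalType) (f : R -> X) :
  continuous f -> continuous (fun s => f (T - s)).
Proof.
move=> cf s; apply: (@continuous_comp _ _ _ (fun s => T - s)); last exact: cf.
by apply: cvgB; [exact: cvg_cst|exact: cvg_id].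
Qed.

(** Splitting the kernel as [expR (- sigma * r) * expR (sigma * s)] frees the integrand of [r],
    which is left only in a prefactor and in the upper limit. *)
Let integrand (f : R -> R) (s : R) := expR (sigma * s) * f (T - s).

Let integrand_continuous f : continuous f -> continuous (integrand f).
Proof.
move=> cf; apply: mul_continuous; first exact: expR_mul_continuous.
exact: reversed_continuous.
Qed.

Lemma discountedE (f : R -> R) (r : R) : continuous f ->
  discounted sigma T f r = sigma * (expR (- sigma * r) *
    \int[mu]_(s in `[0, r]) (expR (sigma * s) * f (T - s))).
Proof.
move=> cf; have ci := integrand_continuous cf.
have int : mu.-integrable `[0, r] (EFin \o integrand f).
  by apply: continuous_integrable; exact: continuous_subspaceT.
rewrite /discounted -(RintegralZl _ _ int)//.
congr (_ * _); apply: eq_Rintegral => s _.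
by rewrite mulrA -expRD mulrBr !mulNr opprK.
Qed.

Lemma discounted_continuous (f : R -> R) : continuous f ->
  {within `[0, T], continuous (discounted sigma T f)}.
Proof.
move=> cf.
rewrite (_ : discounted sigma T f = fun r => sigma * (expR (- sigma * r) *
    parameterized_integral mu 0 r (integrand f))); last first.
  by apply/funext => r; rewrite discountedE.
have ce : {within `[0, T], continuous (fun r : R => expR (- sigma * r))}.
  exact/continuous_subspaceT/expR_mul_continuous.
have cI : {within `[0, T], continuous (fun r =>
    parameterized_integral mu 0 r (integrand f))}.
  apply: parameterized_integral_continuous; first exact: ltW.
  apply: continuous_integrable; apply: continuous_subspaceT.
  exact: integrand_continuous.
apply: mul_continuous; first exact: cst_continuous.
exact: mul_continuous.
Qed.

(* The derivative of [discounted f / sigma] is [f (T - r) - discounted f r]. *)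
Lemma ge0_of_ge_discounted (f : R -> R) : continuous f ->
  {in `[0, T], forall r, discounted sigma T f r <= f (T - r)} ->
  {in `[0, T], forall r, 0 <= f (T - r)}.
Proof.
move=> cf df r rT; apply: le_trans (df _ rT).
(* [h] is the discounted integral divided by [sigma]. It vanishes at 0 and the hypothesis makes its
   derivative nonnegative, so it is nonnegative on [0, T]. *)
pose h (r : R) := expR (- sigma * r) *
  parameterized_integral mu 0 r (integrand f).
have dE s : discounted sigma T f s = sigma * h s by rewrite discountedE.
have hE s : h s = sigma^-1 * discounted sigma T f s.
  by rewrite dE mulKf// gt_eqF.
have ch : {within `[0, T], continuous h}.
  rewrite (_ : h = fun s => sigma^-1 * discounted sigma T f s); last exact/funext.
  by apply: mul_continuous; [exact: cst_continuous|exact: discounted_continuous].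
have dh s : s \in `]0, T[ -> is_derive s 1 h (f (T - s) - discounted sigma T f s).
  rewrite in_itv/= => /andP[s0 sT].
  have cg := integrand_continuous cf.
  have ig : mu.-integrable `[0, T] (EFin \o integrand f).
    by apply: continuous_integrable; exact: continuous_subspaceT.
  have [dI IE] := continuous_FTC1_closed sT ig s0 (cg s).
  have {IE}dI : is_derive s 1 (fun r => parameterized_integral mu 0 r (integrand f))
      (integrand f s).
    by apply: DeriveDef => //; rewrite -derive1E.
  have de : is_derive s 1 (fun r : R => expR (- sigma * r)) (- sigma * expR (- sigma * s)).
    have dl : is_derive s 1 (fun r : R => - sigma * r) (- sigma).
      apply: (is_derive_eq (is_deriveZ (- sigma) (is_derive_id (s : R^o) 1))).
      by rewrite /GRing.scale/= mulr1.
    by apply: (is_derive_eq (is_derive1_comp _ dl)); rewrite mulrC.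
  (* In the product rule the exponentials cancel in the term coming from the integral, leaving
     [f (T - s)]. *)
  apply: (is_derive_eq (is_deriveM de dI)).
  rewrite dE /h /integrand /GRing.scale/= [X in X + _]mulrA -expRD mulNr addNr expR0 mul1r.
  by rewrite mulNr mulrN [in RHS]mulrA [in RHS]mulrC.
have h0 : h 0 = 0.
  by rewrite /h /parameterized_integral set_itv1 Rintegral_set1 mulr0.
rewrite dE; apply: mulr_ge0; first exact: ltW.
move: rT; rewrite in_itv/= => /andP[r0 rT].
have := @ger0_derive1_ndecr _ h 0 T _ _ ch 0 r (lexx _) r0 rT.
rewrite h0; apply => s sT; have [d dhs] := dh s sT => //.
rewrite derive1E dhs subr_ge0; apply: df.
exact: subset_itv_oo_cc.
Qed.
End Discounted.

(** * Integrals of vector-valued functions and of positive parts *)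

Lemma Rintegral_sum (R : realType) (d : nat) (a b : R) (F : 'I_d -> R -> R) :
  (forall i, {within `[a, b], continuous (F i)}) ->
  \int[lebesgue_measure]_(s in `[a, b]) (\sum_(i < d) F i s) =
  \sum_(i < d) \int[lebesgue_measure]_(s in `[a, b]) F i s.
Proof.
elim: d F => [|d IH] F cF.
  rewrite big_ord0; under eq_Rintegral do rewrite big_ord0.
  by rewrite Rintegral_cst// mul0r.
rewrite big_ord_recr/=; under eq_Rintegral do rewrite big_ord_recr/=.
have cS : {within `[a, b], continuous (fun s =>
    \sum_(i < d) F (widen_ord (leqnSn d) i) s)}.
  by apply: sum_continuous => i; exact: cF.
rewrite RintegralD//; [|exact: continuous_integrable..].
by rewrite (IH (fun i => F (widen_ord (leqnSn d) i))).
Qed.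

Lemma Rintegral_dot (R : realType) (d : nat) (a b : R) (v : 'cV[R]_d)
  (Y : R -> 'cV[R]_d) :
  (forall i, {within `[a, b], continuous (fun s => Y s i ord0)}) ->
  \int[lebesgue_measure]_(s in `[a, b]) dot v (Y s) =
  dot v (\col_i \int[lebesgue_measure]_(s in `[a, b]) Y s i ord0).
Proof.
move=> cY; rewrite dotE; under eq_bigr do rewrite mxE.
under [LHS]eq_Rintegral do rewrite dotE.
rewrite Rintegral_sum => [|i]; last first.
  by apply: mul_continuous; [exact: cst_continuous|exact: cY].
by apply: eq_bigr => i _; rewrite RintegralZl//; exact: continuous_integrable.
Qed.

(** Isolates the coefficient vector of [v], so that the lower bound on the Bellman error becomes
    affine in the parameter. *)
Lemma discounted_dot (R : realType) (d : nat) (sigma T r : R) (v : 'cV[R]_d)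
  (Y : R -> 'cV[R]_d) : continuous Y ->
  discounted sigma T (fun t => dot v (Y t)) r =
  dot v (\col_i discounted sigma T (fun t => Y t i ord0) r).
Proof.
move=> cY; rewrite /discounted.
under eq_Rintegral do rewrite -dotZr.
rewrite Rintegral_dot; last first.
  move=> i; apply: continuous_subspaceT.
  under eq_fun do rewrite mxE.
  apply: mul_continuous; last first.
    apply: (@reversed_continuous _ _ _ (fun t => Y t i ord0)).
    exact: coord_comp_continuous.
  move=> s; apply: (@continuous_comp _ _ _ (fun s => - sigma * (r - s)));
    last exact: continuous_expR.
  apply: cvgM; first exact: cvg_cst.
  by apply: cvgB; [exact: cvg_cst|exact: cvg_id].
rewrite -dotZr; congr (dot v _); apply/matrixP => i j; rewrite !mxE.
by congr (_ * _); apply: eq_Rintegral => s _; rewrite mxE.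
Qed.

(** Passing to the positive part first makes the integrand nonnegative, and then enlarging the
    interval can only increase the integral. *)
Lemma Rintegral_le_pos_part (R : realType) (a b c e : R) (f : R -> R) :
  {within `[a, b], continuous f} -> `[c, e] `<=` `[a, b] ->
  \int[lebesgue_measure]_(s in `[c, e]) f s <=
  \int[lebesgue_measure]_(s in `[a, b]) Num.max 0 (f s).
Proof.
move=> cf sub.
have cm : {within `[a, b], continuous (fun s => Num.max 0 (f s))}.
  by move=> s; apply: continuous_max; [exact: cvg_cst|exact: cf].
have ic := continuous_integrable (continuous_subspaceW sub cm).
have i1 := continuous_integrable cm.
apply: (@le_trans _ _ (\int[lebesgue_measure]_(s in `[c, e]) Num.max 0 (f s))).
  apply: le_Rintegral => //.
    exact: continuous_integrable (continuous_subspaceW sub cf).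
  by move=> s _; rewrite le_max lexx orbT.
apply: fine_le; [exact: integrable_fin_num..|].
apply: ge0_subset_integral => //; first exact: measurable_int i1.
by move=> s _; rewrite lee_fin le_max lexx.
Qed.

(** By continuity [f] stays above [f r / 2] near [r]. *)
Lemma pos_Rintegral_subitv (R : realType) (T r : R) (f : R -> R) : 0 < T ->
  {within `[0, T], continuous f} -> r \in `[0, T] -> 0 < f r ->
  exists a b, `[a, b] `<=` `[0, T] /\
    0 < \int[lebesgue_measure]_(s in `[a, b]) f s.
Proof.
move=> T0 cf rT fr0; have /subspace_continuousP/(_ r rT) cfr := cf.
have h0 : f r / 2 < f r by rewrite ltr_pdivrMr// ltr_pMr// ltr1n.
have : \forall s \near r, `[0, T]%classic s -> f r / 2 < f s.
  exact: (cvgr_gt _ cfr _ h0).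
move=> /nbhs_ballP[e /= e0 He].
move: rT; rewrite in_itv/= => /andP[r0 rT].
(* Radius [e / 2] keeps the closed interval inside the open ball. Truncation at 0 and [T] leaves
   positive length even when [r] is an endpoint. *)
pose a := Num.max 0 (r - e / 2); pose b := Num.min T (r + e / 2).
have e20 : 0 < e / 2 by rewrite divr_gt0.
have e2e : e / 2 < e by rewrite ltr_pdivrMr// ltr_pMr// ltr1n.
have ab : a < b.
  rewrite /a /b gt_max !lt_min T0 /=; apply/and3P; split.
  - by rewrite ltr_wpDl.
  - by rewrite (lt_le_trans _ rT)// gtrBl.
  - by rewrite ltrBlDr -addrA ltrDl addr_gt0.
have sub : `[a, b] `<=` `[0, T].
  move=> s /=; rewrite !in_itv/= /a /b ge_max le_min.
  by move=> /andP[/andP[-> _] /andP[-> _]].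
exists a, b; split => //.
have fab s : `[a, b]%classic s -> f r / 2 <= f s.
  move=> sab; apply/ltW/He; last exact: sub.
  move: sab; rewrite /= in_itv/= /a /b ge_max le_min => /andP[/andP[_ h1] /andP[_ h2]].
  rewrite /ball/= (le_lt_trans _ e2e)// ler_distl.
  by rewrite lerBlDr h2 -lerBlDr h1.
apply: (@lt_le_trans _ _ (\int[lebesgue_measure]_(s in `[a, b]) (f r / 2))).
  rewrite Rintegral_cst//= lebesgue_measure_itv/= lte_fin ab/= mulr_gt0//.
    by rewrite divr_gt0.
  by rewrite subr_gt0.
apply: le_Rintegral => //.
  apply: continuous_integrable; apply: continuous_subspaceT; exact: cst_continuous.
exact: continuous_integrable (continuous_subspaceW sub cf).
Qed.

(** * Minimization over controls and continuity of the Bellman error *)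

Lemma Hmin_attained (R : realType) (n m d : nat)
  (psi : 'cV[R]_n -> 'cV[R]_m -> R -> 'cV[R]_d) (theta : 'cV[R]_d)
  (x : 'cV[R]_n) (w : 'cV[R]_m) (t : R) :
  (forall u, Hfun psi theta x w t <= Hfun psi theta x u t) ->
  Hmin psi theta x t = Hfun psi theta x w t.
Proof.
move=> wmin; apply/eqP; rewrite eq_le; apply/andP; split.
  apply: ge_inf; last by exists w.
  by exists (Hfun psi theta x w t) => _ [u _ <-].
by apply: lb_le_inf; [exists (Hfun psi theta x w t), w|move=> _ [u _ <-]].
Qed.

Section Bellman.
Variables (R : realType) (n m d : nat).
Variables (F : 'cV[R]_n -> 'cV[R]_m -> R -> 'cV[R]_n).
Variables (c : 'cV[R]_n -> 'cV[R]_m -> R -> R) (J0 : 'cV[R]_n -> R).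
Variables (psi : 'cV[R]_n -> 'cV[R]_m -> R -> 'cV[R]_d).
Variables (sigma T Tol : R) (x : R -> 'cV[R]_n) (u : R -> 'cV[R]_m).
Hypothesis c_ge0 : forall y w t, 0 <= t -> 0 <= c y w t.
Hypothesis J0_ge0 : forall y, 0 <= J0 y.
Hypotheses (sigma_gt0 : 0 < sigma) (T_gt0 : 0 < T) (Tol_gt0 : 0 < Tol).
Hypothesis A1 : assumption_A1 psi F T c.
Hypothesis xu_traj : input_state_trajectory F T x u.

Let T_ge0 : 0 <= T. Proof. exact: ltW. Qed.

(* Composing with [clamp T] makes the data continuous on all of [R] without
   changing them on [0, T]. *)
Let X := x \o clamp T.
Let U := u \o clamp T.
Let Y (t : R) := psi (X t) (U t) (clamp T t).
Let C (t : R) := c (X t) (U t) (clamp T t).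

Let X_continuous : continuous X.
Proof.
apply: comp_clamp_continuous => //.
by case: xu_traj => + _; exact: state_equation_continuous.
Qed.

Let U_continuous : continuous U.
Proof. by apply: comp_clamp_continuous => //; case: xu_traj. Qed.

(** The control [V] is left free to cover three cases: the given control, the minimizing feedback
    and a frozen constant. *)
Let C1_xut_traj (W : normedModType R) (f : 'cV[R]_n -> 'cV[R]_m -> R -> W)
  (V : R -> 'cV[R]_m) :
  C1_xut f -> continuous V -> continuous (fun t => f (X t) (V t) (clamp T t)).
Proof.
move=> /C1_on_continuous cf cV.
apply: (within_continuous_comp _ _ cf (q := fun t => ((X t, V t), clamp T t))).
  by move=> t /=; have := clamp_itv t T_ge0; rewrite in_itv/= => /andP[].
apply: pair_continuous; first exact: pair_continuous.
exact: clamp_continuous.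
Qed.

Let psi_C1 : C1_xut psi. Proof. by case: A1. Qed.
Let c_C1 : C1_xut c. Proof. by case: A1. Qed.

Let Y_continuous : continuous Y.
Proof. exact: C1_xut_traj. Qed.

Let C_continuous : continuous C.
Proof. exact: C1_xut_traj. Qed.

Let psi_trajE : {in `[0, T], psi_traj psi x u =1 Y}.
Proof. by move=> t tT; rewrite /psi_traj /Y /X /U/= clamp_id. Qed.

Lemma minimizer_exists theta y t : 0 <= t ->
  exists w, forall u', Hfun psi theta y w t <= Hfun psi theta y u' t.
Proof.
by move=> t0; case: A1 => _ _ /(_ theta)[phi [minphi _ _]]; exists (phi y t); exact: minphi.
Qed.

Lemma Hmin_le theta y w t : 0 <= t ->
  Hmin psi theta y t <= Hfun psi theta y w t.
Proof.
by move=> /(minimizer_exists theta y)[w0 w0P]; rewrite (Hmin_attained w0P).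
Qed.

(** A minimizer for [theta] still minimizes after scaling by a nonnegative factor. *)
Lemma HminZ a theta y t : 0 <= a -> 0 <= t ->
  Hmin psi (a *: theta) y t = a * Hmin psi theta y t.
Proof.
move=> a0 /(minimizer_exists theta y)[w wP]; rewrite (Hmin_attained wP).
rewrite (@Hmin_attained _ _ _ _ _ _ _ w) /Hfun ?dotZl// => u'.
by rewrite !dotZl ler_wpM2l//; exact: wP.
Qed.

Let revT r : r \in `[0, T] -> T - r \in `[0, T].
Proof. by rewrite !in_itv/= subr_ge0 lerBlDr lerDl => /andP[-> ->]. Qed.

(** The infimum is the delicate term. The continuous feedback of A1 attains it, so along the
    trajectory it is a composition of continuous maps. *)
Lemma Bellman_continuous theta :
  {within `[0, T], continuous (Bellman psi c J0 sigma T x u theta)}.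
Proof.
have [_ _ /(_ theta)[phi [phi_min phi_cont _]]] := A1.
pose V t := phi (X t) (clamp T t).
have cV : continuous V.
  apply: (within_continuous_comp _ _ phi_cont (q := fun t => (X t, clamp T t))).
    by move=> t /=; have := clamp_itv t T_ge0; rewrite in_itv/= => /andP[].
  by apply: pair_continuous => //; exact: clamp_continuous.
(* The Bellman error with the minimum evaluated at the feedback and all data clamped; the two agree
   on [0, T]. *)
pose B r := - dot theta (psi (X (T - r)) (V (T - r)) (clamp T (T - r)))
  - sigma * expR (- sigma * r) * J0 (x T)
  + discounted sigma T (fun t => dot theta (Y t)) r - discounted sigma T C r.
apply: (@subspace_eq_continuous _ _ _ B).
  move=> r; rewrite inE/= => rT; rewrite /B /Bellman.
  congr (- _ - _ + _ - _).
  - have Tr := revT rT.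
    rewrite (@Hmin_attained _ _ _ _ _ _ _ (phi (x (T - r)) (T - r))).
      by rewrite /V /X/= clamp_id.
    by apply: phi_min; move: Tr; rewrite in_itv/= => /andP[].
  - by apply: eq_discounted => // t tT; rewrite psi_trajE.
  - by apply: eq_discounted => // t tT; rewrite /C /X /U/= clamp_id.
have cH : continuous (fun r => dot theta (psi (X (T - r)) (V (T - r)) (clamp T (T - r)))).
  apply: (@reversed_continuous _ _ _ (fun t => dot theta (psi (X t) (V t) (clamp T t)))).
  apply: dot_comp_continuous; exact: C1_xut_traj.
have cE : continuous (fun r : R => sigma * expR (- sigma * r) * J0 (x T)).
  apply: mul_continuous; last exact: cst_continuous.
  apply: mul_continuous; first exact: cst_continuous.
  exact: expR_mul_continuous.
have cY := @discounted_continuous _ sigma _ T_gt0 _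
  (@dot_comp_continuous _ _ _ theta _ Y_continuous).
have cC := @discounted_continuous _ sigma _ T_gt0 _ C_continuous.
move=> r; apply: cvgB; last exact: cC.
apply: cvgD; last exact: cY.
by apply: cvgB; [apply: cvgN; exact: (continuous_subspaceT cH)|exact: (continuous_subspaceT cE)].
Qed.

Let D (r : R) : 'cV[R]_d := \col_i discounted sigma T (fun t => Y t i ord0) r.

Let discounted_trajE theta : {in `[0, T], forall r,
  discounted sigma T (fun t => dot theta (psi_traj psi x u t)) r = dot theta (D r)}.
Proof.
move=> r rT; rewrite -discounted_dot//.
by apply: eq_discounted => // t tT; rewrite psi_trajE.
Qed.

Let discounted_costE : {in `[0, T], forall r,
  discounted sigma T (fun t => c (x t) (u t) t) r = discounted sigma T C r}.
Proof.
move=> r rT; apply: eq_discounted => // t tT.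
by rewrite /C /X /U/= clamp_id.
Qed.

(** * From boundedness to E2: rays contained in [Theta] *)

Lemma Bellman_le0 theta a : 0 <= a ->
  {in `[0, T], forall r,
    discounted sigma T (fun t => dot theta (psi_traj psi x u t)) r
      <= Hmin psi theta (x (T - r)) (T - r)} ->
  {in `[0, T], forall r, Bellman psi c J0 sigma T x u (a *: theta) r <= 0}.
Proof.
move=> a0 H r rT; rewrite /Bellman.
have Tr : 0 <= T - r by move: (revT rT); rewrite in_itv/= => /andP[].
have c0 : 0 <= discounted sigma T (fun t => c (x t) (u t) t) r.
  by apply: discounted_ge0 => // t; rewrite in_itv/= => /andP[t0 _]; exact: c_ge0.
have J0' : 0 <= sigma * expR (- sigma * r) * J0 (x T).
  by rewrite !mulr_ge0// ?expR_ge0// ltW.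
(* Only the part linear in the parameter scales with [a], and it is nonpositive; both cost terms are
   subtracted. *)
have := ler_wpM2l a0 (H r rT).
rewrite HminZ// !discounted_trajE// dotZl; lra.
Qed.

Lemma Theta_scale theta a : 0 <= a ->
  {in `[0, T], forall r,
    discounted sigma T (fun t => dot theta (psi_traj psi x u t)) r
      <= Hmin psi theta (x (T - r)) (T - r)} ->
  Theta psi c J0 sigma T x u Tol (a *: theta).
Proof.
move=> a0 H; rewrite /Theta/= (@eq_Rintegral _ _ _ _ _ (cst 0)).
  by rewrite Rintegral_cst// mul0r mulr0 ltW.
by move=> r; rewrite inE/= => rT; apply: max_l; exact: Bellman_le0.
Qed.

Lemma bounded_Theta_E2 : bounded_set (Theta psi c J0 sigma T x u Tol) ->
  condition_E2 psi sigma T x u.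
Proof.
move=> [M [_ ThetaM]] v; split => [H|-> r /andP[r0 rT]].
  apply/eqP; apply: contraT => v0.
  have nv : 0 < `|v| by rewrite normr_gt0.
  (* [K] is positive and exceeds [M], so it bounds the norms in [Theta]; the multiple of [v] of norm
     [2 * K] lies on the ray and violates this bound. *)
  pose K := Num.max 0 M + 1.
  have K0 : 0 < K by rewrite /K ltr_wpDl// le_max lexx.
  have MK : M < K by rewrite /K ltr_pwDr// le_max lexx orbT.
  have := ThetaM K MK ((2 * K / `|v|) *: v).
  rewrite /mkset normrZ ger0_norm; last by rewrite ltW// divr_gt0// mulr_gt0.
  rewrite divfK ?gt_eqF// => /(_ _)/wrap[]; last by lra.
  apply: Theta_scale; first by rewrite ltW// divr_gt0// mulr_gt0.
  by move=> r; rewrite in_itv/=; exact: H.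
(* For the zero vector both sides of the inequality are 0. *)
have rI : r \in `[0, T] by rewrite in_itv/= r0.
rewrite discounted_trajE// dot0l (@Hmin_attained _ _ _ _ _ _ _ 0) /Hfun ?dot0l//.
by move=> w; rewrite !dot0l.
Qed.

(** * From E1 to boundedness: half spaces that confine [Theta] *)

Lemma Hmin_lt_discounted v : v != 0 -> condition_E1 psi T x u ->
  exists2 r, r \in `[0, T] &
    Hmin psi v (x (T - r)) (T - r) <
    discounted sigma T (fun t => dot v (psi_traj psi x u t)) r.
Proof.
move=> v0 E1; apply: contrapT => nH.
have H : {in `[0, T], forall r, discounted sigma T (fun t => dot v (Y t)) r <= dot v (Y (T - r))}.
  move=> r rT; have Tr := revT rT.
  have Tr0 : 0 <= T - r by move: Tr; rewrite in_itv/= => /andP[].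
  rewrite -psi_trajE//.
  (* The control of the trajectory competes in the minimum, so [Hmin] is at most the integrand
     itself. *)
  apply: le_trans (Hmin_le v (x (T - r)) (u (T - r)) Tr0).
  rewrite discounted_dot// -discounted_trajE// leNgt; apply/negP => lt.
  by apply: nH; exists r.
apply: (E1 [set y | 0 <= dot v y]); first by exists v.
move=> _ [t /= tT <-]; rewrite psi_trajE//.
have := ge0_of_ge_discounted sigma_gt0 T_gt0 (@dot_comp_continuous _ _ _ v _ Y_continuous) H.
by move=> /(_ (T - t) (revT tT)); rewrite subKr.
Qed.

Lemma Theta_half_space v : v != 0 -> condition_E1 psi T x u ->
  exists P K, 0 < dot v P /\
    forall theta, Theta psi c J0 sigma T x u Tol theta -> dot theta P <= K.
Proof.
move=> v0 /(Hmin_lt_discounted v0)[r0 r0T].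
have Tr0 := revT r0T.
have Tr00 : 0 <= T - r0 by move: Tr0; rewrite in_itv/= => /andP[].
(* [w] is optimal for [v] at time [T - r0] only; for other parameters and times it is merely a
   competitor, which still bounds [Hmin] from above. *)
have [w wP] := minimizer_exists v (x (T - r0)) Tr00.
rewrite (Hmin_attained wP) discounted_trajE// => Hlt.
pose Z t := psi (X t) w (clamp T t).
have cZ : continuous (fun r => Z (T - r)).
  apply: (@reversed_continuous _ _ _ Z); apply: C1_xut_traj => //.
  exact: cst_continuous.
pose p r := - Z (T - r) + D r.
have cp i : {within `[0, T], continuous (fun r => p r i ord0)}.
  rewrite (_ : (fun r => _) = fun r => - Z (T - r) i ord0 +
      discounted sigma T (fun t => Y t i ord0) r); last first.
    by apply/funext => r; rewrite /p /D !mxE.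
  have cZi := @coord_comp_continuous _ _ _ _ i cZ.
  have cDi := @discounted_continuous _ sigma _ T_gt0 _ (@coord_comp_continuous _ _ _ _ i Y_continuous).
  move=> r; apply: cvgD; last exact: cDi.
  by apply: cvgN; exact: (continuous_subspaceT cZi).
have cvp : {within `[0, T], continuous (fun r => dot v (p r))}.
  exact: dot_continuous.
have vp : 0 < dot v (p r0).
  rewrite /p dotDr dotNr /Z /X/= clamp_id// addrC subr_gt0; exact: Hlt.
have [a [b [sub vP]]] := pos_Rintegral_subitv T_gt0 cvp r0T vp.
(* [k] gathers the cost terms, which do not depend on the parameter. *)
pose k r := sigma * expR (- sigma * r) * J0 (x T) + discounted sigma T C r.
have ck : {within `[0, T], continuous k}.
  have cE : continuous (fun r : R => sigma * expR (- sigma * r) * J0 (x T)).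
    apply: mul_continuous; last exact: cst_continuous.
    apply: mul_continuous; first exact: cst_continuous.
    exact: expR_mul_continuous.
  have cC := @discounted_continuous _ sigma _ T_gt0 _ C_continuous.
  by move=> r; apply: cvgD; [exact: (continuous_subspaceT cE)|exact: cC].
exists (\col_i \int[lebesgue_measure]_(r in `[a, b]) p r i ord0).
(* [T * Tol] bounds the integral of the positive part over [0, T]; the second term moves the costs
   to the other side. *)
exists (T * Tol + \int[lebesgue_measure]_(r in `[a, b]) k r).
have cpab i := continuous_subspaceW sub (cp i).
have ik := continuous_integrable (continuous_subspaceW sub ck).
split; first by rewrite -Rintegral_dot.
move=> theta; rewrite /Theta/= mulrC ler_pdivrMr// [_ * T]mulrC => B.
have cdp : {within `[a, b], continuous (fun r => dot theta (p r))}.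
  exact: dot_continuous.
have ip := continuous_integrable cdp.
have ipk : lebesgue_measure.-integrable `[a, b]
    (EFin \o (fun r => dot theta (p r) - k r)).
  apply: continuous_integrable => r.
  by apply: cvgB; [exact: cdp|exact: (continuous_subspaceW sub ck)].
rewrite -Rintegral_dot// -lerBlDr -RintegralB//.
apply: le_trans B.
have cB := @Bellman_continuous theta.
apply: le_trans (Rintegral_le_pos_part cB sub).
have iB := continuous_integrable (continuous_subspaceW sub cB).
apply: le_Rintegral => //.
move=> r /sub rT; have Tr := revT rT.
have Tr_ge0 : 0 <= T - r by move: Tr; rewrite in_itv/= => /andP[].
rewrite /Bellman discounted_trajE// discounted_costE// /p /k dotDr dotNr.
have := Hmin_le theta (x (T - r)) w Tr_ge0.
rewrite /Hfun /Z /X/= clamp_id//; lra.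
Qed.

End Bellman.

Theorem proposition3p3 (R : realType) (n m d : nat)
  (F : 'cV[R]_n -> 'cV[R]_m -> R -> 'cV[R]_n)
  (c : 'cV[R]_n -> 'cV[R]_m -> R -> R) (J0 : 'cV[R]_n -> R)
  (psi : 'cV[R]_n -> 'cV[R]_m -> R -> 'cV[R]_d)
  (sigma T Tol : R) (x : R -> 'cV[R]_n) (u : R -> 'cV[R]_m)
  (c_ge0 : forall y w t, 0 <= t -> 0 <= c y w t)
  (J0_ge0 : forall y, 0 <= J0 y)
  (sigma_gt0 : 0 < sigma) (T_gt0 : 0 < T) (Tol_gt0 : 0 < Tol)
  (A1 : assumption_A1 psi F T c)
  (xu_traj : input_state_trajectory F T x u) :
  (condition_E1 psi T x u ->
     bounded_set (Theta psi c J0 sigma T x u Tol)) /\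
  (bounded_set (Theta psi c J0 sigma T x u Tol) ->
     condition_E2 psi sigma T x u).
Proof.
split => [E1|].
  apply: bounded_set_of_half_spaces => v v0.
  exact: (Theta_half_space _ _ _ _ A1 xu_traj).
exact: (bounded_Theta_E2 _ _ _ _ _ A1 xu_traj).
Qed.
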